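(* Let $k\geq 1$ and $n\geq 2k+1$ be integers. If $G$ is a bipartite graph of order $n$ such that $\kappa(\overline{G})\geq k$, then $$\rho(G)\leq\rho(B_{n,k}),$$ with equality if and only if $G\cong B_{n,k}$.
   Context: All graphs are finite, simple and undirected. $\rho(G)$ denotes the largest eigenvalue of the adjacency matrix of $G$, and $\overline{G}$ is the complement of $G$. The vertex-connectivity $\kappa(H)$ is the minimum number of vertices whose deletion disconnects $H$ or leaves a single vertex; in particular $\kappa(K_n)=n-1$. For $n\geq 2k$, $B_{n,k}$ is the graph obtained from the complete bipartite graph $K_{\lceil n/2\rceil,\lfloor n/2\rfloor}$ by deleting the edges of a matching of size $k$ (up to isomorphism, independent of the matching chosen). *)

(* Defs.v *)
From mathcomp Require Import all_boot all_order all_algebra.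
From mathcomp Require Import classical_sets reals.

Set Implicit Arguments.
Unset Strict Implicit.
Unset Printing Implicit Defensive.

Import GRing.Theory Num.Theory.

Record sgraph := SGraph {
  vertex :> finType;
  edge : rel vertex;
  edge_sym : symmetric edge;
  edge_irrefl : irreflexive edge }.

Definition compl_edge (G : sgraph) : rel G :=
  fun x y => (x != y) && ~~ edge x y.

Lemma compl_edge_sym (G : sgraph) : symmetric (@compl_edge G).
Proof. by move=> x y; rewrite /compl_edge eq_sym edge_sym. Qed.

Lemma compl_edge_irrefl (G : sgraph) : irreflexive (@compl_edge G).
Proof. by move=> x; rewrite /compl_edge eqxx. Qed.

Definition compl (G : sgraph) : sgraph :=
  SGraph (@compl_edge_sym G) (@compl_edge_irrefl G).

Definition isomorphic (G H : sgraph) : Prop :=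
  exists f : G -> H, bijective f /\ forall x y, edge (f x) (f y) = edge x y.

(* One of the two colour classes A, ~: A may be empty. *)
Definition bipartite (G : sgraph) : Prop :=
  exists A : {set G}, forall x y : G, edge x y -> (x \in A) != (y \in A).

Definition deleted_edge (G : sgraph) (S : {set G}) : rel G :=
  fun x y => [&& x \notin S, y \notin S & edge x y].

Definition disconnects (G : sgraph) (S : {set G}) : bool :=
  [exists x in ~: S, exists y in ~: S, ~~ connect (deleted_edge S) x y].

(* If G is nonempty, deleting all vertices but one always qualifies, so the
   minimum is over a nonempty family and the default #|G| is not reached. *)
Definition kappa (G : sgraph) : nat :=
  \big[minn/#|G|]_(S : {set G} | disconnects S || (#|~: S| == 1)) #|S|.

Definition adjmx (R : realType) (G : sgraph) : 'M[R]_#|G| :=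
  (\matrix_(i, j) (edge (enum_val i) (enum_val j))%:R)%R.

(* For #|G| > 0 the adjacency matrix is real symmetric, hence its set of
   eigenvalues is finite and nonempty and sup is its maximum. *)
Definition rho (R : realType) (G : sgraph) : R :=
  sup [set a | eigenvalue (adjmx R G) a]%classic.

(* The parts have sizes uphalf n (ceiling of n/2) and n./2 (floor of n/2); the
   deleted matching joins the i-th vertices of both parts for i < k, hence has
   size k as soon as k <= n./2. *)
Definition B_edge (n k : nat) : rel ('I_(uphalf n) + 'I_n./2) :=
  fun x y => match x, y with
  | inl i, inr j | inr j, inl i => ~~ ((i == j :> nat) && (i < k))
  | _, _ => false
  end.

Lemma B_edge_sym n k : symmetric (@B_edge n k).
Proof. by case=> i [] j. Qed.

Lemma B_edge_irrefl n k : irreflexive (@B_edge n k).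
Proof. by case. Qed.

Definition B (n k : nat) : sgraph :=
  SGraph (@B_edge_sym n k) (@B_edge_irrefl n k).

(* Main.v *)
(** If both colour classes have at least k vertices, a vertex cover of fewer
    than k of the non-edges between the classes would disconnect the complement;
    so by Konig's theorem G misses a k-matching of K_{a,b}, i.e. G is a spanning
    subgraph of a host K_{a,b} - kK_2. The square of the spectral radius of the
    host is the larger root of
      (t - (a - k)) (t - (b - k)) - t (a - 1) (b - 1),
    which for fixed a + b increases with ab once t > 1, so the balanced host
    B_{n,k} wins. If a class has fewer than k vertices, then kappa being at
    most the minimum degree bounds the degrees by n - k - 1 in this class and by
    k - 1 in the other, and (k - 1)(n - k - 1) is below that root. All upper
    bounds on eigenvalues come from positive supersolutions (Collatz-Wielandt);
    in case of equality, the support of an eigenvector is closed under adjacency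
    in the balanced host, which is connected except for K_{2,1} minus an edge. *)
Require Import Defs.
From mathcomp Require Import all_boot all_order all_algebra.
From mathcomp Require Import classical_sets reals.
From mathcomp Require Import boolp fintype finset.
From mathcomp Require Import ring lra zify.

Set Implicit Arguments.
Unset Strict Implicit.
Unset Printing Implicit Defensive.

Import Order.TTheory GRing.Theory Num.Theory.

(** * Eigenvalues of the adjacency matrix and the spectral radius *)

Section Spectrum.
Local Open Scope ring_scope.
Variable R : realType.

(** Eigenvectors as functions on vertices, so that no enumeration of the vertices enters. *)
Definition eigenfun (T : finType) (e : rel T) (a : R) (v : T -> R) : Prop :=
  (exists x, v x != 0) /\ forall x, \sum_(y | e x y) v y = a * v x.

Lemma eigenvalue_adjmxP (G : sgraph) (a : R) :
  eigenvalue (adjmx R G) a <-> exists v, eigenfun (@edge G) a v.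
Proof.
have adjE (v : 'rV[R]_#|G|) j :
    (v *m adjmx R G) 0 j = \sum_(y | edge (enum_val j) y) v 0 (enum_rank y).
  rewrite mxE (reindex_onto enum_rank enum_val) /=; last by move=> i _; rewrite enum_valK.
  rewrite [RHS]big_mkcond /=.
  apply: eq_big => [y|y _]; first by rewrite enum_rankK eqxx.
  by rewrite mxE enum_rankK edge_sym; case: edge; rewrite ?mulr1 ?mulr0.
split=> [/eigenvalueP[v vA v0]|[v [[x vx] vA]]].
  exists (fun x => v 0 (enum_rank x)); split.
    have /rV0Pn[i vi] := v0.
    by exists (enum_val i); rewrite enum_valK.
  move=> x; have /rowP /(_ (enum_rank x)) := vA.
  by rewrite adjE enum_rankK mxE.
apply/eigenvalueP; exists (\row_i v (enum_val i)).
  apply/rowP=> j; rewrite adjE !mxE -vA.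
  by apply: eq_bigr => y _; rewrite mxE enum_rankK.
by apply/rV0Pn; exists (enum_rank x); rewrite mxE enum_rankK.
Qed.

Lemma isomorphic_eigenvalue (G H : sgraph) (a : R) :
  isomorphic G H -> eigenvalue (adjmx R G) a <-> eigenvalue (adjmx R H) a.
Proof.
case=> f [[g fK gK] fe]; split=> /eigenvalue_adjmxP[v [[x vx] vA]];
    apply/eigenvalue_adjmxP.
  exists (v \o g); split=> [|y]; first by exists (f x); rewrite /= fK.
  rewrite (reindex f) /=; last by exists g => z _; rewrite ?fK ?gK.
  rewrite -vA; apply: eq_big => [z|z _]; last by rewrite fK.
  by rewrite -{1}(gK y) fe.
exists (v \o f); split=> [|y]; first by exists (g x); rewrite /= gK.
rewrite /= -vA [RHS](reindex f) /=; last by exists g => z _; rewrite ?fK ?gK.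
by apply: eq_bigl => z; rewrite fe.
Qed.

Lemma isomorphic_rho (G H : sgraph) : isomorphic G H -> rho R G = rho R H.
Proof.
move=> GH; rewrite /rho; congr (sup _).
by apply/seteqP; split=> a /=; have [] := isomorphic_eigenvalue a GH.
Qed.

Lemma rho_le (G : sgraph) (b : R) :
    0 <= b -> (forall a, eigenvalue (adjmx R G) a -> a <= b) -> rho R G <= b.
Proof.
move=> b0 eb; rewrite /rho.
(* An empty spectrum has [sup] 0 by default, which [0 <= b] covers. *)
have [->|/set0P ne] := eqVneq [set a | eigenvalue (adjmx R G) a]%classic classical_sets.set0.
  by rewrite sup0.
exact: ge_sup.
Qed.

Lemma rho_eq_max (G : sgraph) (b : R) :
    0 <= b -> eigenvalue (adjmx R G) b ->
    (forall a, eigenvalue (adjmx R G) a -> a <= b) -> rho R G = b.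
Proof.
move=> b0 Eb eb; apply/eqP; rewrite eq_le rho_le //=.
by apply: ub_le_sup => //; exists b.
Qed.

(** A nonzero [sup] is not the default 0 taken on empty or unbounded sets, so it is a true supremum,
    attained because the spectrum is finite. *)
Lemma eigenvalue_rho (G : sgraph) :
  rho R G != 0 -> eigenvalue (adjmx R G) (rho R G).
Proof.
set E := [set a | eigenvalue (adjmx R G) a]%classic.
rewrite -[rho R G]/(sup E) => s0.
have neE : (E !=set0)%classic.
  by apply/set0P/negP => /eqP E0; rewrite E0 sup0 eqxx in s0.
have p0 : char_poly (adjmx R G) != 0 by rewrite monic_neq0 ?char_poly_monic.
apply/negP/negP; apply: contraT => /negP nEs.
have ubE : has_ubound E.
  by apply: contrapT => nub; move: s0; rewrite sup_out ?eqxx // => -[].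
(* If the supremum were not attained, larger and larger eigenvalues would
   give the characteristic polynomial too many roots. *)
have up a : E a -> exists2 b, E b & a < b.
  move=> Ea; have [b Eb ab] := sup_gt neE (sup_ub_strict ubE nEs Ea).
  by exists b.
have [x0 Ex0] := neE.
have chain m : exists s : seq R,
    [/\ size s = m.+1, sorted >%R s & {in s, forall a, E a}].
  elim: m => [|m [[|x s] [ss srt sE]]] //.
    by exists [:: x0]; split=> // a; rewrite inE => /eqP ->.
  have [y Ey xy] := up x (sE x (mem_head _ _)).
  exists (y :: x :: s); split; [by rewrite -ss | by rewrite /= xy |].
  by move=> a; rewrite inE => /predU1P[-> //|/sE].
have [s [ss srt sE]] := chain (size (char_poly (adjmx R G))).
have su : uniq s by apply: sorted_uniq srt => [u v w uv vw|]; [exact: lt_trans vw uv | exact: ltxx].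
have /(max_poly_roots p0) /(_ su) : all (root (char_poly (adjmx R G))) s.
  by apply/allP => a /sE /=; rewrite -eigenvalue_root_char.
by rewrite ss ltnNge leqW.
Qed.

(** * Collatz-Wielandt bounds from a positive supersolution *)

Section Collatz.
Variables (T : finType) (e : rel T).
Hypothesis e_sym : symmetric e.
Variables (z : T -> R) (b : R).
Hypothesis z_gt0 : forall x, 0 < z x.
Hypothesis z_sup : forall x, \sum_(y | e x y) z y <= b * z x.

(** Self-adjointness of the adjacency operator. *)
Lemma sum_nbr_swap (v w : T -> R) :
  \sum_x v x * \sum_(y | e x y) w y = \sum_x w x * \sum_(y | e x y) v y.
Proof.
under eq_bigr do rewrite mulr_sumr; under [RHS]eq_bigr do rewrite mulr_sumr.
rewrite (exchange_big_dep xpredT) //=; apply: eq_bigr => y _.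
by apply: eq_big => [x|x _]; [rewrite e_sym | rewrite mulrC].
Qed.

Lemma eigenfun_norm_le (a : R) (v : T -> R) x :
  eigenfun e a v -> a * `|v x| <= \sum_(y | e x y) `|v y|.
Proof.
case=> _ vA; apply: le_trans (ler_norm_sum _ _ _).
by rewrite vA normrM ler_wpM2r // ler_norm.
Qed.

(** Pairing with z and moving the adjacency operator N across gives a<z,|v|> <= <z,N|v|> = <|v|,Nz>
    <= b<z,|v|>, where <z,|v|> is positive. *)
Lemma collatz_le (a : R) (v : T -> R) : eigenfun e a v -> a <= b.
Proof.
move=> ev; have [[x vx] _] := ev.
have S0 : 0 < \sum_x z x * `|v x|.
  rewrite (bigD1 x) //= ltr_pwDl ?mulr_gt0 ?normr_gt0 //.
  by apply: sumr_ge0 => y _; rewrite mulr_ge0 // ltW.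
rewrite -(ler_pM2r S0) !mulr_sumr.
apply: (@le_trans _ _ (\sum_x z x * \sum_(y | e x y) `|v y|)).
  apply: ler_sum => y _; rewrite mulrCA ler_wpM2l ?(ltW (z_gt0 _)) //.
  exact: eigenfun_norm_le.
rewrite sum_nbr_swap; apply: ler_sum => y _.
by rewrite mulrA mulrC ler_wpM2r.
Qed.

(** When the eigenvalue is b, the pointwise defects of the chain in [collatz_le] are nonnegative
    with sum 0, so each vanishes; dividing by [z x], resp. by [|v x|], gives the two claims. *)
Lemma collatz_eq (v : T -> R) x : eigenfun e b v ->
  \sum_(y | e x y) `|v y| = b * `|v x| /\
  (v x != 0 -> \sum_(y | e x y) z y = b * z x).
Proof.
move=> ev.
have d1 y : 0 <= z y * (\sum_(u | e y u) `|v u| - b * `|v y|).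
  by rewrite mulr_ge0 ?subr_ge0 ?(ltW (z_gt0 _)) // eigenfun_norm_le.
have d2 y : 0 <= `|v y| * (b * z y - \sum_(u | e y u) z u).
  by rewrite mulr_ge0 ?subr_ge0.
have : \sum_y (z y * (\sum_(u | e y u) `|v u| - b * `|v y|) +
              `|v y| * (b * z y - \sum_(u | e y u) z u)) = 0.
  rewrite (eq_bigr (fun y => z y * \sum_(u | e y u) `|v u| -
                            `|v y| * \sum_(u | e y u) z u)); last by move=> y _; ring.
  by rewrite sumrB sum_nbr_swap subrr.
move/psumr_eq0P => /(_ (fun y _ => addr_ge0 (d1 y) (d2 y))) /(_ x isT) /eqP.
rewrite paddr_eq0 // => /andP[]; rewrite !mulf_eq0 gt_eqF //= subr_eq0.
move=> /eqP e1 /orP; rewrite normr_eq0 subr_eq0 => e2.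
split=> // vx; case: e2 => [v0|/eqP ->//]; by rewrite v0 in vx.
Qed.

End Collatz.
End Spectrum.

(** * Konig's theorem *)

Section Konig.
Variable T : finType.
Implicit Types (E : {set T * T}) (C D : {set T}).

(** E is read as a bipartite graph between two disjoint copies of T, and a vertex cover as a pair of
    sets, one in each copy. *)
Definition bicover E C D :=
  [forall p in E, (p.1 \in C) || (p.2 \in D)].

Lemma bicoverP E C D :
  reflect (forall x y, (x, y) \in E -> (x \in C) || (y \in D)) (bicover E C D).
Proof.
apply: (iffP forall_inP) => [c x y /c //|c [x y]]; exact: c.
Qed.

Definition cover_ge k E :=
  [forall C, forall D, bicover E C D ==> (k <= #|C| + #|D|)].

Lemma cover_geP k E :
  reflect (forall C D, bicover E C D -> k <= #|C| + #|D|) (cover_ge k E).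
Proof.
by apply: (iffP forallP) => h C; [move=> D | apply/forallP => D];
  [have /forallP /(_ D) /implyP := h C | apply/implyP; apply: h].
Qed.

Definition flip E : {set T * T} := [set p | (p.2, p.1) \in E].

Lemma flipK : involutive flip.
Proof. by move=> E; apply/setP=> -[x y]; rewrite !inE. Qed.

Lemma bicover_flip E C D : bicover (flip E) C D = bicover E D C.
Proof.
by apply/bicoverP/bicoverP => h x y; [have := h y x | have := h y x];
  rewrite inE /= orbC.
Qed.

Lemma cover_ge_flip k E : cover_ge k (flip E) = cover_ge k E.
Proof.
by apply/cover_geP/cover_geP => h C D; rewrite ?bicover_flip => c;
  rewrite addnC; apply: h; rewrite ?bicover_flip.
Qed.

(* Lovasz: if two edges of a minimal E shared x, covers of size < k of E minus
   either edge avoid x; uncrossing them yields two covers of E which are too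
   small on average. *)
Lemma minset_cover_ge_fst k E x y y' :
  minset (cover_ge k) E -> (x, y) \in E -> (x, y') \in E -> y = y'.
Proof.
move=> /minsetP[/cover_geP Ek Emin] xy xy'; apply/eqP/negPn/negP => yy'.
have small p : p \in E -> exists C D, bicover (E :\ p) C D /\ #|C| + #|D| < k.
  move=> pE; have: ~~ cover_ge k (E :\ p).
    apply/negP => /Emin /(_ (subsetDl _ _)) Ep.
    by move: pE; rewrite -Ep !inE eqxx.
  case/forallPn => C /forallPn[D]; rewrite negb_imply -ltnNge => /andP[? ?].
  by exists C, D.
have [C [D [/bicoverP c1 lt1]]] := small _ xy.
have [C' [D' [/bicoverP c2 lt2]]] := small _ xy'.
have out p q (A F : {set T}) : (forall u v, (u, v) \in E :\ (p, q) -> (u \in A) || (v \in F)) ->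
    #|A| + #|F| < k -> p \notin A.
  move=> c lt; apply/negP => pA; suff /Ek : bicover E A F by rewrite leqNgt lt.
  apply/bicoverP => u v uv.
  have [[-> _]|] := eqVneq (u, v) (p, q); first by rewrite pA.
  by move=> ne; apply: c; rewrite !inE ne.
have xC := out _ _ _ _ c1 lt1; have xC' := out _ _ _ _ c2 lt2.
have yD' : y \in D'.
  have := c2 x y; rewrite (negPf xC') /=; apply.
  by rewrite !inE xy andbT; apply/eqP => -[/eqP]; rewrite (negPf yy').
have yD : y' \in D.
  have := c1 x y'; rewrite (negPf xC) /=; apply.
  by rewrite !inE xy' andbT; apply/eqP => -[/eqP]; rewrite eq_sym (negPf yy').
have b1 : bicover E (C :&: C') (D :|: D').
  apply/bicoverP => u v uv; rewrite !inE.
  have [[_ ->]|n1] := eqVneq (u, v) (x, y); first by rewrite yD' !orbT.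
  have [[_ ->]|n2] := eqVneq (u, v) (x, y'); first by rewrite yD !orbT.
  have := c1 u v; have := c2 u v; rewrite !inE n1 n2 uv => /(_ isT) h1 /(_ isT) h2.
  by case/orP: h1 => ->; case/orP: h2 => ->; rewrite ?orbT.
have b2 : bicover E (x |: (C :|: C')) (D :&: D').
  apply/bicoverP => u v uv; rewrite !inE.
  have [->//|ux] := eqVneq u x.
  have ne w : (u, v) != (x, w) by apply: contraNneq ux => -[->].
  have := c1 u v; have := c2 u v; rewrite !inE !ne uv => /(_ isT) h1 /(_ isT) h2.
  by case/orP: h1 => ->; case/orP: h2 => ->; rewrite ?orbT.
(* The two covers together have at most 2(k - 1) + 1 vertices, but should have at least 2k. *)
have := Ek _ _ b1; have := Ek _ _ b2.
have := cardsUI C C'; have := cardsUI D D'.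
have := cardsU1 x (C :|: C'); have := leq_b1 (x \notin C :|: C'); lia.
Qed.

Lemma minset_flip k E : minset (cover_ge k) E -> minset (cover_ge k) (flip E).
Proof.
move=> /minsetP[Ek Emin]; apply/minsetP; rewrite cover_ge_flip; split=> // F Fk FE.
rewrite -(flipK F); congr flip; apply: Emin; first by rewrite cover_ge_flip.
by apply/subsetP => -[x y]; rewrite inE /=  => /(subsetP FE); rewrite inE.
Qed.

(** In a minimal edge set with covering number at least k no two edges share an end, and the first
    ends form a cover, so it is a matching with at least k edges. *)
Lemma konig k E : cover_ge k E -> exists M : {set T * T},
  [/\ M \subset E, #|M| = k, {in M &, injective fst} & {in M &, injective snd}].
Proof.
move=> /minset_exists[M minM ME].
have inj1 : {in M &, injective fst}.
  move=> [x y] [x' y'] xM x'M /= xx'; rewrite -xx' in x'M *.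
  by rewrite (minset_cover_ge_fst minM xM x'M).
have inj2 : {in M &, injective snd}.
  move=> [x y] [x' y'] xM x'M /= yy'; rewrite -yy' in x'M *.
  congr (_, _); apply: (@minset_cover_ge_fst k (flip M) y).
  - exact: minset_flip.
  - by rewrite inE.
  - by rewrite inE.
have kM : k <= #|M|.
  have /minsetp /cover_geP /(_ (fst @: M) set0) := minM.
  rewrite cards0 addn0 (card_in_imset inj1); apply.
  by apply/bicoverP => x y xyM; rewrite (imset_f fst xyM).
have [N [NM cN]] : exists N : {set T * T}, N \subset M /\ #|N| = k.
  exists [set p in take k (enum M)]; split.
    by apply/subsetP => p; rewrite inE => /mem_take; rewrite mem_enum.
  rewrite cardsE; have /card_uniqP -> : uniq (take k (enum M)).
    by rewrite take_uniq ?enum_uniq.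
  by rewrite size_takel // -cardE.
exists N; split=> //; first exact: subset_trans NM ME.
  by move=> p q /(subsetP NM) pM /(subsetP NM); exact: inj1.
by move=> p q /(subsetP NM) pM /(subsetP NM); exact: inj2.
Qed.

End Konig.

(** * Vertex-connectivity of the complement *)

Section Connectivity.
Implicit Types G : sgraph.

Lemma bigminn_le_cond (I : finType) (P : pred I) (F : I -> nat) d i :
  P i -> \big[minn/d]_(j | P j) F j <= F i.
Proof.
have : i \in index_enum I by rewrite mem_index_enum.
elim: (index_enum I) => // j s IHs; rewrite inE big_cons => /predU1P[<-|js] Pi.
  by rewrite Pi geq_minl.
by case: (P j); rewrite ?geq_min IHs ?orbT.
Qed.

Lemma kappa_le_disconnects G (S : {set G}) : disconnects S -> kappa G <= #|S|.
Proof. by move=> dS; apply: bigminn_le_cond; rewrite dS. Qed.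

(** Deleting the neighbours of x either leaves x alone or separates it from a remaining vertex. *)
Lemma kappa_le_degree G (x : G) : kappa G <= #|[set y | edge x y]|.
Proof.
set S := [set y | edge x y]; have xS : x \notin S by rewrite inE edge_irrefl.
apply: bigminn_le_cond; have [|c1] := eqVneq #|~: S| 1; first by rewrite orbT.
rewrite orbF; have /set0Pn[y] : ~: S :\ x != set0.
  have := cardsD1 x (~: S); rewrite in_setC xS /=.
  by rewrite -card_gt0; lia.
rewrite in_setD1 => /andP[yx yS]; apply/existsP; exists x; rewrite in_setC xS /=.
apply/existsP; exists y; rewrite yS /=; apply/negP => /connectP[[|z p] /=].
  by move=> _ /eqP; rewrite (negPf yx).
by case/andP=> /and3P[_]; rewrite inE => /negPf ->.
Qed.

(** Once a cover is deleted, all remaining pairs across the classes are edges of G, so no complement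
    edge leaves A; a cover with fewer than k vertices exhausts neither class. *)
Lemma compl_cover_ge G (A : {set G}) k :
    k <= #|A| -> k <= #|~: A| -> k <= kappa (compl G) ->
  cover_ge k [set p | [&& p.1 \in A, p.2 \notin A & ~~ @edge G p.1 p.2]].
Proof.
move=> kA kB kK; apply/cover_geP => C D /bicoverP cCD.
rewrite leqNgt; apply/negP => lt.
pose S : {set compl G} := C :|: D.
have ltS : #|S| < k 
  by apply: leq_ltn_trans lt; rewrite [#|S|](cardsU C D) leq_subr.
suff /kappa_le_disconnects : disconnects S.
  by move=> /(leq_trans kK); rewrite leqNgt ltS.
have ex (F : {set G}) : k <= #|F| -> exists2 x, x \in F & x \notin S.
  move=> kF; have /subsetPn[x xF xS] : ~~ (F \subset S).
    by apply/negP => /subset_leq_card /(leq_trans kF); rewrite leqNgt ltS.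
  by exists x.
have [x xA xS] := ex A kA; have [y yA yS] := ex _ kB.
apply/existsP; exists x; rewrite in_setC xS /=.
apply/existsP; exists y; rewrite in_setC yS /=.
have clA : closed (@deleted_edge (compl G) S) (mem A).
  move=> u v /and3P[uS vS /andP[_ uv]].
  have no (p q : G) : p \notin S -> q \notin S -> ~~ edge p q ->
      p \in A -> q \in A.
    rewrite !inE !negb_or => /andP[pC _] /andP[_ qD] pq pA.
    apply: contraT => qA; have := cCD p q; rewrite inE /= pA qA pq => /(_ isT).
    by rewrite (negPf pC) (negPf qD).
  by apply/idP/idP; apply: no => //; rewrite edge_sym.
apply/negP => /(closed_connect clA) /=; rewrite xA.
by move: yA; rewrite in_setC => /negPf ->.
Qed.

End Connectivity.

(** * The quadratic whose larger root is the squared spectral radius *)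

Section Quadratic.
Local Open Scope ring_scope.
Variable R : realType.

(** A point s0 with nonpositive value makes the discriminant nonnegative. *)
Lemma larger_root (c d s0 : R) : s0 ^+ 2 - c * s0 + d <= 0 ->
  exists t, t ^+ 2 - c * t + d = 0 /\ forall s, s ^+ 2 - c * s + d <= 0 -> s <= t.
Proof.
move=> q0; pose D := c ^+ 2 - 4 * d; pose r := Num.sqrt D.
have D0 : 0 <= D by rewrite /D; have := sqr_ge0 (2 * s0 - c); nra.
have r2 : r ^+ 2 = D by rewrite sqr_sqrtr.
have r0 : 0 <= r by apply: sqrtr_ge0.
exists ((c + r) / 2); split; first by move: r2; rewrite /D; nra.
move=> s qs; suff : 2 * s - c <= r by lra.
have [s0c|s0c] := lerP (2 * s - c) 0; first by lra.
by rewrite -ler_sqr ?nnegrE ?(ltW s0c) // r2 /D; nra.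
Qed.

(* The square of the spectral radius of K_{a,b} minus a k-matching is the
   larger root of this polynomial in t. *)
Definition charq (a b k t : R) : R :=
  (t - (a - k)) * (t - (b - k)) - t * (a - 1) * (b - 1).

(** The larger root, given by its maximality: a lower bound on t then only takes one evaluation of
    [charq]. *)
Definition is_top (a b k t : R) : Prop :=
  charq a b k t = 0 /\ forall s, charq a b k s <= 0 -> s <= t.

Lemma charqE a b k t :
  charq a b k t = t ^+ 2 - (a * b - 2 * k + 1) * t + (a - k) * (b - k).
Proof. by rewrite /charq; ring. Qed.

Lemma exists_top a b k : 1 <= k -> k <= a -> k <= b ->
  exists t, is_top a b k t.
Proof.
move=> k1 ka kb.
(* At a - k the first product of [charq] vanishes. *)
have [|t [qt tmax]] := @larger_root (a * b - 2 * k + 1) ((a - k) * (b - k)) (a - k).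
  by rewrite -charqE /charq subrr mul0r sub0r oppr_le0 !mulr_ge0 ?subr_ge0 //; lra.
by exists t; split=> [|s]; rewrite charqE //; exact: tmax.
Qed.

Lemma top_ge1 a b k t : 1 <= k -> k <= a -> k <= b -> 2 * k + 1 <= a + b ->
  is_top a b k t -> 1 <= t.
Proof.
move=> k1 ka kb kab [_]; apply.
have -> : charq a b k 1 = k * (k + 2 - (a + b)) by rewrite /charq; ring.
by nra.
Qed.

Lemma top_gt1 a b k t : 1 <= k -> k <= a -> k <= b -> 2 * k + 1 <= a + b ->
  4 <= a + b -> is_top a b k t -> 1 < t.
Proof.
move=> k1 ka kb kab ab4 top; rewrite lt_neqAle (top_ge1 _ _ _ _ top) // andbT.
apply/eqP => t1; case: top => + _; rewrite -t1.
have -> : charq a b k 1 = k * (k + 2 - (a + b)) by rewrite /charq; ring.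
by nra.
Qed.

(** For a fixed sum, passing to a', b' lowers the quadratic at t by (t - 1)(a'b' - ab), so it is
    negative there. *)
Lemma top_mono a b a' b' k t t' : a + b = a' + b' -> a * b < a' * b' ->
  1 < t -> is_top a b k t -> is_top a' b' k t' -> t < t'.
Proof.
move=> ab lt t1 [qt _] [qt' tmax].
have e : charq a' b' k t = charq a b k t - (t - 1) * (a' * b' - a * b).
  have -> : b = a' + b' - a by lra.
  by rewrite /charq; ring.
have neg : charq a' b' k t < 0.
  by rewrite e qt sub0r oppr_lt0 mulr_gt0 // subr_gt0.
rewrite lt_neqAle tmax ?(ltW neg) // andbT.
by apply: contraTneq neg => ->; rewrite qt' ltxx.
Qed.

(** For use with integers: [n ^+ 2 - 1 <= 4 * (a * b)] expresses parts differing by at most one, and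
    [k = 1 \/ 2 <= k] integrality of k. *)
Lemma small_lt_top a b k n t : 1 <= k -> k <= a -> k <= b -> 2 * k + 1 <= n ->
  a + b = n -> n ^+ 2 - 1 <= 4 * (a * b) -> (k = 1 \/ 2 <= k) ->
  is_top a b k t -> (k - 1) * (n - k - 1) < t.
Proof.
move=> k1 ka kb kn abn bal kk top; have t1 : 1 <= t by apply: top_ge1 top => //; lra.
case: kk => [->|k2]; first by rewrite subrr mul0r; lra.
case: top => qt tmax; set s := _ * _.
have s2 : 2 <= s by rewrite /s; nra.
(* With g = ab - 2k + 1 the quadratic at s is (a - k)(b - k) - s(g - s). Putting r = n - 2k - 1,
   [gap] bounds g - s below by 1 + r + (r^2 + 2r)/4, and [up] bounds the constant term by (r +
   1)^2/4. *)
have gap : 1 + (n - 2 * k - 1) + ((n - 2 * k - 1) ^+ 2 + 2 * (n - 2 * k - 1)) / 4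
    <= a * b - 2 * k + 1 - s by rewrite /s; nra.
have up : (a - k) * (b - k) <= (n - 2 * k) ^+ 2 / 4.
  have := sqr_ge0 (a - b); rewrite -abn; nra.
have neg : charq a b k s < 0.
  rewrite charqE; set g := _ - _ + 1 in gap *.
  have : s * (g - s) >= 2 * (g - s) by rewrite ler_wpM2r //; nra.
  by nra.
rewrite lt_neqAle tmax ?(ltW neg) // andbT.
by apply: contraTneq neg => ->; rewrite qt ltxx.
Qed.

End Quadratic.

(** * Complete bipartite graphs minus a matching *)

Section Host.
Variables (T : finType) (A : {set T}) (m : T -> T).
Hypothesis mK : involutive m.
Hypothesis mA : forall p, m p != p -> (m p \in A) = (p \notin A).

(** The deleted matching is encoded by an involution m whose fixed points are the unmatched
    vertices. *)
Definition host : rel T := fun p q => ((p \in A) != (q \in A)) && (m p != q).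

Lemma host_sym : symmetric host.
Proof. by move=> p q; rewrite /host [(p \in A) == _]eq_sym (inv_eq mK) [p == _]eq_sym. Qed.

Definition class s := [set q | (q \in A) == s].
Definition matched s := [set q in class s | m q != q].

Lemma card_matched s : #|matched s| = #|matched true|.
Proof.
case: s => //; rewrite -(card_imset _ (inv_inj mK)); apply: eq_card => q.
apply/imsetP/idP => [[p]|]; rewrite !inE ?eqbF_neg ?eqb_id => /andP[qA mq].
  by move=> ->; rewrite mA // qA mK eq_sym.
by exists (m q); rewrite ?mK // !inE eqbF_neg mA // qA mK eq_sym.
Qed.

Local Open Scope ring_scope.
Variables (R : realType) (g : bool -> bool -> R).
(** Constant on the four cells, by side and by being matched, of an equitable partition of the
    host. *)
Definition weight q := g (q \in A) (m q != q).

Lemma sum_class s : \sum_(q in class s) weight q =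
  #|matched true|%:R * g s true + (#|class s|%:R - #|matched true|%:R) * g s false.
Proof.
rewrite (bigID (fun q => m q != q)) /=.
rewrite (eq_bigr (fun=> g s true)); last first.
  by move=> q /andP[]; rewrite inE /weight => /eqP -> ->.
rewrite [X in _ + X](eq_bigr (fun=> g s false)); last first.
  by move=> q /andP[]; rewrite inE /weight => /eqP -> /negPf ->.
rewrite !sumr_const -(card_matched s).
have <- : #|matched s| = #|[pred i | (i \in class s) && (m i != i)]|.
  by apply: eq_card => q; rewrite !inE.
rewrite -[X in X%:R - _](cardID (fun q => m q != q)).
have -> : #|[predI class s & fun q => m q != q]| = #|matched s|.
  by apply: eq_card => q; rewrite !inE.
have -> : #|[predD class s & fun q => m q != q]| =
         #|[pred i | (i \in class s) && ~~ (m i != i)]|.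
  by apply: eq_card => q; rewrite !inE andbC.
by rewrite natrD -[g s true *+ _]mulr_natl -[g s false *+ _]mulr_natl; ring.
Qed.

(** A vertex sees the whole opposite class except its mate, hence the last term. *)
Lemma sum_host p : \sum_(q | host p q) weight q =
  #|matched true|%:R * g (p \notin A) true +
  (#|class (p \notin A)|%:R - #|matched true|%:R) * g (p \notin A) false -
  (if m p != p then g (p \notin A) true else 0).
Proof.
rewrite -sum_class; have [mp|mp] := eqVneq (m p) p; rewrite ?subr0.
  apply: eq_bigl => q; rewrite /host inE mp.
  have [<-|_] := eqVneq p q; first by case: (p \in A).
  by rewrite andbT; case: (p \in A); case: (q \in A).
rewrite [X in _ = X - _](bigD1 (m p)) /=; last by rewrite inE mA.
rewrite {2}/weight mK [p == _]eq_sym mp mA // addrC addrK.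
apply: eq_bigl => q; rewrite /host inE [q == _]eq_sym.
by case: (p \in A); case: (q \in A).
Qed.

End Host.

(** * Supersolutions and eigenfunctions of the host *)

Section Weights.
Local Open Scope ring_scope.
Variable R : realType.

(* The ansatz solving the quotient eigenvalue equations of K_{a,b} minus a
   matching: x, y are the values on the matched vertices of either side. *)
Definition profile (l x y : R) (inA is_matched : bool) : R :=
  if inA then (if is_matched then x else x + y / l)
  else (if is_matched then y else y + x / l).

Variables (T : finType) (A : {set T}) (m : T -> T).
Hypothesis mK : involutive m.
Hypothesis mA : forall p, m p != p -> (m p \in A) = (p \notin A).

Let a : R := #|A|%:R.
Let b : R := #|~: A|%:R.
Let k : R := #|matched A m true|%:R.

(** Matched and unmatched vertices of one side have the same defect. The two numerators are linear
    in x, y, with determinant [charq a b k (l ^+ 2)]. *)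
Lemma sum_host_profile (l x y : R) p : l != 0 ->
  let w := weight A m (profile l x y) in
  \sum_(q | host A m p q) w q = l * w p -
   (if p \in A then (l ^+ 2 - (b - k)) * x - (b - 1) * (l * y)
    else (l ^+ 2 - (a - k)) * y - (a - 1) * (l * x)) / l.
Proof.
move=> l0 /=; rewrite (sum_host mK mA) /weight -/k.
have -> : #|class A (p \notin A)|%:R = (if p \in A then b else a).
  by rewrite /a /b; case: (p \in A); congr (_%:R); apply: eq_card => q;
    rewrite !inE ?eqbF_neg ?eqb_id.
by case: (p \in A); case: (m p == p) => /=; field.
Qed.

Hypothesis a_gt1 : 1 < a.

Section Bound.
Variables (e : rel T) (l : R).
Hypothesis e_sym : symmetric e.
Hypothesis e_host : subrel e (host A m).
Hypothesis l_gt0 : 0 < l.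
Hypothesis l_gtak : a - k < l ^+ 2.
Hypothesis l_charq : 0 <= charq a b k (l ^+ 2).

(** With these values the defect is 0 outside A and [charq a b k (l ^+ 2) / l] on A. *)
Let w := weight A m (profile l (l ^+ 2 - (a - k)) (l * (a - 1))).

Lemma profile_gt0 p : 0 < w p.
Proof.
have x0 : 0 < l ^+ 2 - (a - k) by rewrite subr_gt0.
have y0 : 0 < l * (a - 1) by rewrite mulr_gt0 ?subr_gt0.
by rewrite /w /weight /profile; do 2!case: ifP => _ //; rewrite addr_gt0 ?divr_gt0.
Qed.

Lemma sum_host_le p : \sum_(q | host A m p q) w q <= l * w p.
Proof.
rewrite sum_host_profile ?gt_eqF // gerBl divr_ge0 ?(ltW l_gt0) //.
case: ifP => _; last by rewrite [leRHS](_ : _ = 0) //; ring.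
by move: l_charq; rewrite /charq; lra.
Qed.

Lemma sum_sub_host_le p : \sum_(q | e p q) w q <= l * w p.
Proof.
apply: le_trans (sum_host_le p); rewrite [leRHS](bigID (e p)) /=.
rewrite [X in _ <= X + _](eq_bigl (e p)); last first.
  by move=> q /=; case epq: (e p q); rewrite ?andbF ?(e_host epq).
by rewrite lerDl sumr_ge0 // => q _; rewrite ltW // profile_gt0.
Qed.

Lemma eigenfun_le_of_charq c v : eigenfun e c v -> c <= l.
Proof.
exact: (collatz_le e_sym profile_gt0 sum_sub_host_le).
Qed.

(** A host edge missing at p would make the sum of w at p too small for the equality case; and a
    neighbour q of p has the positive term [|v p|] in its sum, so v does not vanish at q. *)
Lemma eigenfun_saturated v p : eigenfun e l v -> v p != 0 ->
  e p =1 host A m p /\ forall q, host A m p q -> v q != 0.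
Proof.
move=> ev vp.
have [v1 /(_ vp) v2] := collatz_eq e_sym profile_gt0 sum_sub_host_le p ev.
have ep : e p =1 host A m p.
  move=> q; apply/idP/idP => [|hpq]; first exact: e_host.
  apply: contraT => nepq; have := sum_host_le p.
  rewrite -v2 (bigID (e p)) /= (eq_bigl (e p)); last first.
    by move=> u /=; case epu: (e p u); rewrite ?andbF ?(e_host epu).
  rewrite gerDl (bigD1 q) /= ?hpq // leNgt ltr_pwDl ?profile_gt0 //.
  by rewrite sumr_ge0 // => u _; rewrite ltW // profile_gt0.
split=> // q; rewrite -ep => epq.
have eqp : e q p by rewrite e_sym.
have [vq _] := collatz_eq e_sym profile_gt0 sum_sub_host_le q ev.
rewrite -normr_gt0 -(pmulr_rgt0 _ l_gt0) -vq (bigD1 p) //=.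
by rewrite ltr_pwDl ?normr_gt0 // sumr_ge0.
Qed.

End Bound.

Hypothesis k_ge1 : 1 <= k.
Hypothesis k_leb : k <= b.
Hypothesis k_lta : k < a.

Variable t : R.
Hypothesis t_top : is_top a b k t.
Hypothesis t_gt0 : 0 < t.

Lemma top_ge_sub : a - k <= t.
Proof.
case: t_top => _; apply; rewrite /charq subrr mul0r sub0r oppr_le0.
by rewrite !mulr_ge0 ?subr_ge0 ?(ltW k_lta) ?(ltW a_gt1) ?(le_trans k_ge1 k_leb).
Qed.

Lemma eigenfun_le_top (e : rel T) c v :
  symmetric e -> subrel e (host A m) -> eigenfun e c v -> c <= Num.sqrt t.
Proof.
move=> e_sym eh ev; rewrite leNgt; apply/negP => tc.
have c0 : 0 < c by apply: le_lt_trans tc; apply: sqrtr_ge0.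
have tc2 : t < c ^+ 2.
  by rewrite -(sqr_sqrtr (ltW t_gt0)) ltr_sqr ?nnegrE ?sqrtr_ge0 ?ltW.
(* At t itself the strict bound on a - k can fail, as it does for b = 1; it holds at any s above t,
   where the quadratic is also positive. *)
pose s := (t + c ^+ 2) / 2.
have ts : t < s by rewrite /s; lra.
have s0 : 0 < s by apply: lt_trans ts.
have : c <= Num.sqrt s.
  apply: eigenfun_le_of_charq e_sym eh _ _ _ _ _ ev; rewrite ?sqrtr_gt0 //.
    by rewrite sqr_sqrtr ?ltW //; apply: le_lt_trans ts; apply: top_ge_sub.
  rewrite sqr_sqrtr ?(ltW s0) // leNgt; apply/negP => /ltW.
  by case: t_top => _ /[apply]; rewrite leNgt ts.
by rewrite -ler_sqr ?nnegrE ?sqrtr_ge0 ?(ltW c0) // sqr_sqrtr ?(ltW s0) // /s; lra.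
Qed.

(** At l^2 = t the determinant vanishes, so the profile solves the quotient equations exactly. *)
Lemma eigenfun_host : exists v, eigenfun (host A m) (Num.sqrt t) v.
Proof.
set l := Num.sqrt t; have l0 : 0 < l by rewrite sqrtr_gt0.
have l2 : l ^+ 2 = t by rewrite sqr_sqrtr ?ltW.
exists (weight A m (profile l (t - (a - k)) (l * (a - 1)))); split.
  (* The profile is nonzero at a matched vertex outside A; its value t - (a - k) on matched vertices
     of A may vanish. *)
  have : (0 < #|matched A m false|)%N.
    by rewrite card_matched // -(ltr_nat R); apply: lt_le_trans k_ge1.
  case/card_gt0P => p; rewrite !inE eqbF_neg => /andP[/negPf pA mp].
  by exists p; rewrite /weight /profile pA mp gt_eqF // mulr_gt0 ?subr_gt0.
move=> p; rewrite sum_host_profile ?gt_eqF // l2.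
case: t_top => [+ _]; rewrite /charq => qt.
case: ifP => _.
  have -> : (t - (b - k)) * (t - (a - k)) - (b - 1) * (l * (l * (a - 1))) = 0.
    by rewrite -[RHS]qt -l2; ring.
  by rewrite mul0r subr0.
have -> : (t - (a - k)) * (l * (a - 1)) - (a - 1) * (l * (t - (a - k))) = 0 by ring.
by rewrite mul0r subr0.
Qed.

Lemma eigenfun_top_host (e : rel T) v : 1 < b -> symmetric e ->
  subrel e (host A m) -> eigenfun e (Num.sqrt t) v -> e =2 host A m.
Proof.
move=> b1 e_sym eh ev.
have l2 : Num.sqrt t ^+ 2 = t by rewrite sqr_sqrtr ?ltW.
have tak : a - k < t.
  (* If t = a - k, the equation reduces to (a - k)(a - 1)(b - 1) = 0, which 1 < b excludes. *)
  rewrite lt_neqAle top_ge_sub andbT; apply/eqP => tak.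
  case: t_top => + _; rewrite -tak /charq subrr mul0r sub0r => /eqP.
  by rewrite oppr_eq0 !mulf_eq0 !subr_eq0 !gt_eqF.
have sat p : v p != 0 -> e p =1 host A m p /\ forall q, host A m p q -> v q != 0.
  move=> vp; apply: (eigenfun_saturated e_sym eh _ _ _ ev vp); rewrite ?sqrtr_gt0 ?l2 //.
  by case: t_top => ->.
(* The host is connected: the unmatched p0 in A is adjacent to all of ~: A,
   and every vertex of A has a neighbour in ~: A. *)
have [p0 p0A /eqP mp0] : exists2 p, p \in A & m p == p.
  have /subsetPn[p pA] : ~~ (A \subset matched A m true).
    by apply/negP => /subset_leq_card; rewrite leqNgt -(ltr_nat R) k_lta.
  by rewrite !inE pA /= negbK => mp; exists p.
have nbr p : p \in A -> exists2 q, q \notin A & host A m p q.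
  move=> pA; have /subsetPn[q qA qm] : ~~ (~: A \subset [set m p]).
    apply/negP => /subset_leq_card; rewrite cards1 -(ler_nat R) -/b.
    by rewrite leNgt b1.
  rewrite inE in qA; rewrite inE eq_sym in qm.
  by exists q; rewrite // /host pA (negPf qA) qm.
have supA p : v p != 0 -> exists2 q, q \notin A & v q != 0.
  move=> vp; have [pA|pA] := boolP (p \in A); last by exists p.
  by have [q qA pq] := nbr p pA; exists q; rewrite // (sat p vp).2.
have vp0 : v p0 != 0.
  have [[p vp] _] := ev; have [q qA vq] := supA p vp.
  apply: (sat q vq).2; rewrite host_sym // /host p0A (negPf qA) mp0.
  by apply: contraNneq qA => <-.
have vB q : q \notin A -> v q != 0.
  move=> qA; apply: (sat p0 vp0).2; rewrite /host p0A (negPf qA) mp0.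
  by apply: contraNneq qA => <-.
have vA p : v p != 0.
  have [pA|] := boolP (p \in A); last exact: vB.
  have [q qA pq] := nbr p pA; apply: (sat q (vB q qA)).2.
  by rewrite host_sym.
by move=> p q; have [-> _] := sat p (vA p).
Qed.

End Weights.

(** * From matchings to involutions *)

Section MatchingInvolution.
Variables (T : finType) (A : {set T}) (M : {set T * T}).
Hypothesis M_bip : forall x y, (x, y) \in M -> x \in A /\ y \notin A.
Hypothesis M_fst : {in M &, injective fst}.
Hypothesis M_snd : {in M &, injective snd}.

Definition mate (p : T) : T :=
  odflt p [pick q | ((p, q) \in M) || ((q, p) \in M)].

Lemma mate_fst x y : (x, y) \in M -> mate x = y.
Proof.
move=> xy; rewrite /mate; case: pickP => [z /orP[xz|zx]|/(_ y)]; last by rewrite xy.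
  by have /(_ erefl)[] := M_fst xz xy.
by have [_ /negP[]] := M_bip zx; have [] := M_bip xy.
Qed.

Lemma mate_snd x y : (x, y) \in M -> mate y = x.
Proof.
move=> xy; rewrite /mate; case: pickP => [z /orP[yz|zy]|/(_ x)]; last by rewrite xy orbT.
  by have [_ /negP[]] := M_bip xy; have [] := M_bip yz.
by have /(_ erefl)[] := M_snd zy xy.
Qed.

Lemma mate_neq p : mate p != p -> (p, mate p) \in M \/ (mate p, p) \in M.
Proof. by rewrite /mate; case: pickP => [q /orP|]; rewrite ?eqxx. Qed.

Lemma mateK : involutive mate.
Proof.
move=> p; have [e|/mate_neq[/mate_snd|/mate_fst] //] := eqVneq (mate p) p.
by rewrite !e.
Qed.

Lemma mate_side p : mate p != p -> (mate p \in A) = (p \notin A).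
Proof. by case/mate_neq => /M_bip[-> /negPf ->]. Qed.

Lemma mateE p q : p \in A -> q \notin A -> (mate p == q) = ((p, q) \in M).
Proof.
move=> pA qA; apply/eqP/idP => [e|]; last exact: mate_fst.
have /mate_neq[|/M_bip[_]] : mate p != p by rewrite e; apply: contraNneq qA => ->.
  by rewrite e.
by rewrite pA.
Qed.

Lemma card_mate : #|matched A mate true| = #|M|.
Proof.
rewrite -(card_in_imset M_fst); apply: eq_card => p; apply/idP/imsetP.
  rewrite !inE eqb_id => /andP[pA /mate_neq[pM|]]; first by exists (p, mate p).
  by case/M_bip => _ /negP.
case=> -[x y] xyM -> /=; have [xA yA] := M_bip xyM.
by rewrite !inE eqb_id xA (mate_fst xyM); apply: contraNneq yA => ->.
Qed.

End MatchingInvolution.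

(** * The graph B_{n,k} as the balanced host *)

Lemma B_host n k : k <= n./2 ->
  exists (A : {set B n k}) (m : B n k -> B n k),
  [/\ involutive m, forall p, m p != p -> (m p \in A) = (p \notin A),
      #|matched A m true| = k, #|A| = uphalf n /\ #|~: A| = n./2
    & @edge (B n k) =2 host A m].
Proof.
move=> kn; have kn' : k <= uphalf n by lia.
pose A : {set B n k} := [set u : B n k | if u is inl _ then true else false].
pose M : {set B n k * B n k} := [set p : B n k * B n k |
  if p is (inl i, inr j) then (i == j :> nat) && (i < k) else false].
have M_bip x y : (x, y) \in M -> x \in A /\ y \notin A.
  by rewrite !inE; case: x y => [i|i] [j|j].
have M_fst : {in M &, injective fst}.
  move=> [[i|i] [j|j]] [[i'|i'] [j'|j']]; rewrite !inE //=.
  move=> /andP[/eqP ij _] /andP[/eqP ij' _] [ii]; rewrite ii.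
  by congr (_, inr _); apply: val_inj; rewrite /= -ij -ij' ii.
have M_snd : {in M &, injective snd}.
  move=> [[i|i] [j|j]] [[i'|i'] [j'|j']]; rewrite !inE //=.
  move=> /andP[/eqP ij _] /andP[/eqP ij' _] [jj]; rewrite jj.
  by congr (inl _, _); apply: val_inj; rewrite /= ij ij' jj.
have cM : #|M| = k.
  pose h (i : 'I_k) : B n k * B n k := (inl (widen_ord kn' i), inr (widen_ord kn i)).
  have h_inj : injective h by move=> i j [e _]; apply: val_inj.
  rewrite -[RHS]card_ord -[RHS](card_imset _ h_inj); apply: eq_card => p.
  apply/idP/imsetP => [|[i _ ->]]; last by rewrite inE /= eqxx ltn_ord.
  case: p => [[i|i] [j|j]]; rewrite inE //= => /andP[/eqP ij ik].
  by exists (Ordinal ik) => //; congr (inl _, inr _); apply: val_inj; rewrite /= ?ij.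
have cA : #|A| = uphalf n.
  rewrite -[RHS]card_ord -[RHS](card_imset _ (@inl_inj _ 'I_(n./2))).
  apply: eq_card => -[i|i]; rewrite inE /=; first by rewrite imset_f.
  by apply/esym/imsetP => -[].
exists A, (mate M); split.
- exact: mateK M_bip M_fst M_snd.
- exact: mate_side M_bip.
- by rewrite card_mate.
- by split=> //; have := cardsC A; rewrite cA card_sum !card_ord; lia.
have hAB i j : edge (inl i : B n k) (inr j) = host A (mate M) (inl i) (inr j).
  by rewrite /host (mateE M_bip) ?inE.
move=> [i|i] [j|j] //; first by rewrite /host !inE.
  by rewrite (host_sym A (mateK M_bip M_fst M_snd)) -hAB.
by rewrite /host !inE.
Qed.

(** A is listed with its matched vertices first, its complement with their mates first and in the
    same order. Mapping a vertex to its position gives mates equal positions below k. *)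
Lemma host_isomorphic_B (G : sgraph) (A : {set G}) (m : G -> G) n k :
    involutive m -> (forall p, m p != p -> (m p \in A) = (p \notin A)) ->
    #|matched A m true| = k -> #|A| = uphalf n -> #|~: A| = n./2 ->
    0 < n./2 -> @edge G =2 host A m ->
  isomorphic G (B n k).
Proof.
move=> mK mA ck cA cB n2 eh.
pose l1 := enum (matched A m true).
pose s1 := l1 ++ enum (A :\: matched A m true).
pose s2 := map m l1 ++ enum (~: A :\: matched A m false).
have sz1 : size l1 = k by rewrite -cardE.
have in_s1 p : (p \in s1) = (p \in A).
  rewrite mem_cat !mem_enum !inE eqb_id.
  by case: (p \in A); case: (m p == p).
have m_l1 q : (m q \in l1) = (q \notin A) && (m q != q).
  rewrite mem_enum !inE eqb_id mK [q == _]eq_sym.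
  by have [e|ne] := eqVneq (m q) q; rewrite ?andbF // mA.
have in_s2 q : (q \in s2) = (q \notin A).
  rewrite mem_cat -{1}(mK q) (mem_map (inv_inj mK)) m_l1 mem_enum !inE eqbF_neg.
  by case: (q \in A); case: (m q == q).
have sub1 : matched A m true \subset A.
  by apply/subsetP => p; rewrite !inE eqb_id => /andP[].
have sub2 : matched A m false \subset ~: A.
  by apply/subsetP => p; rewrite !inE eqbF_neg => /andP[].
have size1 : size s1 = uphalf n.
  rewrite size_cat sz1 -cardE cardsD (setIidPr sub1) ck -cA.
  by rewrite subnKC // -ck subset_leq_card.
have size2 : size s2 = n./2.
  rewrite size_cat size_map sz1 -cardE cardsD (setIidPr sub2) (card_matched mK mA) ck -cB.
  by rewrite subnKC // -ck -(card_matched mK mA false) subset_leq_card.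
have n1 : 0 < uphalf n by lia.
pose f (p : G) : B n k := if p \in A then inl (insubd (Ordinal n1) (index p s1))
                          else inr (insubd (Ordinal n2) (index p s2)).
have f1 p : p \in A -> exists2 i, f p = inl i & i = index p s1 :> nat.
  move=> pA; rewrite /f pA; eexists; first by [].
  by rewrite val_insubd (_ : _ < _ = true) // -size1 index_mem in_s1.
have f2 p : p \notin A -> exists2 i, f p = inr i & i = index p s2 :> nat.
  move=> pA; rewrite /f (negPf pA); eexists; first by [].
  by rewrite val_insubd (_ : _ < _ = true) // -size2 index_mem in_s2.
have idx_inj (s : seq G) p q : p \in s -> q \in s -> index p s = index q s -> p = q.
  by move=> ps qs e; rewrite -(nth_index p ps) e nth_index.
have f_inj : injective f.
  move=> p q; have [pA|pA] := boolP (p \in A); have [qA|qA] := boolP (q \in A).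
  - have [i -> ei] := f1 p pA; have [j -> ej] := f1 q qA => -[eij].
    by apply: (idx_inj s1); rewrite ?in_s1 // -ei -ej eij.
  - by have [i ->] := f1 p pA; have [j ->] := f2 q qA.
  - by have [i ->] := f2 p pA; have [j ->] := f1 q qA.
  - have [i -> ei] := f2 p pA; have [j -> ej] := f2 q qA => -[eij].
    by apply: (idx_inj s2); rewrite ?in_s2 // -ei -ej eij.
have key p q : p \in A -> q \notin A ->
    (index p s1 == index q s2) && (index p s1 < k) = (m p == q).
  (* An unmatched p comes after the k matched vertices, so its position is at least k. *)
  move=> pA qA; have [e|ne] := eqVneq (m p) p.
    rewrite e (_ : (p == q) = false); last by apply: contraNF qA => /eqP <-.
    rewrite /s1 index_cat mem_enum !inE e eqxx andbF sz1.
    by rewrite [_ + _ < k]ltnNge leq_addr andbF.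
  have pl : p \in l1 by rewrite mem_enum !inE pA ne.
  have e1 : index p s1 = index p l1 by rewrite /s1 index_cat pl.
  have -> : index p s1 < k by rewrite e1 -sz1 index_mem.
  have e2 : index (m p) s2 = index p s1.
    by rewrite e1 /s2 index_cat (mem_map (inv_inj mK)) pl (index_map (inv_inj mK)).
  rewrite andbT -e2; apply/eqP/eqP => [|-> //].
  by apply: idx_inj; rewrite in_s2 ?mA ?pA.
have fAB p q : p \in A -> q \notin A -> edge (f p) (f q) = edge p q.
  move=> pA qA; have [i -> ei] := f1 p pA; have [j -> ej] := f2 q qA.
  by rewrite eh /= ei ej key // /host pA (negPf qA).
exists f; split.
  apply: inj_card_bij f_inj _.
  by rewrite card_sum !card_ord -(cardsC A) cA cB.
move=> p q; have [pA|pA] := boolP (p \in A); have [qA|qA] := boolP (q \in A).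
- have [i -> _] := f1 p pA; have [j -> _] := f1 q qA.
  by rewrite eh /host pA qA.
- exact: fAB.
- by rewrite edge_sym fAB // edge_sym.
- have [i -> _] := f2 p pA; have [j -> _] := f2 q qA.
  by rewrite eh /host (negPf pA) (negPf qA).
Qed.

(** The difference n^2 - 4ud is (u - d)^2, which is 0 or 1. *)
Lemma sqr_le_uphalf_half n : n ^ 2 <= (4 * (uphalf n * n./2)).+1.
Proof.
have : n = uphalf n + n./2 by lia.
have : n./2 <= uphalf n <= n./2.+1 by lia.
move: (uphalf n) n./2 => u d /andP[du ud] ->; nia.
Qed.

(** The products differ by (d - b)(u - b), and b < d <= u. *)
Lemma mul_lt_uphalf_half a b :
  b <= a -> a != uphalf (a + b) -> a * b < uphalf (a + b) * (a + b)./2.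
Proof.
move=> ba ne; set u := uphalf _ in ne *; set d := _./2.
have ea : a = u + (d - b) by lia.
have -> : d = b + (d - b) by lia.
by rewrite {1}ea mulnDl mulnDr ltn_add2l mulnC ltn_pmul2r; lia.
Qed.

(** * Spectral radii of B_{n,k} and of its competitors *)

Section Comparison.
Local Open Scope ring_scope.
Variable R : realType.

Lemma rho_B n k t : (1 <= k)%N -> (2 * k + 1 <= n)%N ->
  is_top (uphalf n)%:R (n./2)%:R k%:R t -> rho R (B n k) = Num.sqrt t.
Proof.
move=> k1 kn top; have kd : (k <= n./2)%N by lia.
have [A [m [mK mA ck [cA cB] eh]]] := B_host kd.
have rk1 : 1 <= k%:R :> R by rewrite ler1n.
have rkd : k%:R <= n./2%:R :> R by rewrite ler_nat.
have rku : k%:R < (uphalf n)%:R :> R by rewrite ltr_nat; lia.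
have ru1 : 1 < (uphalf n)%:R :> R by rewrite ltr1n; lia.
have t1 : 1 <= t.
  apply: top_ge1 top => //; first exact: ltW.
  by rewrite -natrM natr1 -natrD ler_nat; lia.
rewrite -ck -cA -cB in top rk1 rkd rku ru1.
have t0 : 0 < t by lra.
have sym : symmetric (@edge (B n k)) by exact: edge_sym.
apply: rho_eq_max; first exact: sqrtr_ge0.
  apply/eigenvalue_adjmxP.
  have [v [v0 vA]] := eigenfun_host mK mA ru1 rk1 top t0.
  by exists v; split=> // p; rewrite -vA; apply: eq_bigl => q; rewrite eh.
move=> c /eigenvalue_adjmxP[v ev].
apply: (eigenfun_le_top mK mA ru1 rk1 rkd rku top t0 sym _ ev).
by move=> p q; rewrite eh.
Qed.

(** Degrees are at most k - 1 in A and n - k - 1 outside, so the function equal to the root of s on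
    A and to n - k - 1 elsewhere is a supersolution. *)
Lemma eigenvalue_small_part (G : sgraph) (A : {set G}) n k (c s : R) :
  (forall x y : G, edge x y -> (x \in A) != (y \in A)) ->
  #|G| = n -> (k <= kappa (compl G))%N -> (2 * k + 1 <= n)%N -> (#|~: A| < k)%N ->
  0 < s -> (k%:R - 1) * (n%:R - k%:R - 1) <= s ->
  eigenvalue (adjmx R G) c -> c <= Num.sqrt s.
Proof.
move=> bipA cG kK kn Bk s0 ss /eigenvalue_adjmxP[v ev].
pose z (p : G) : R := if p \in A then Num.sqrt s else n%:R - k%:R - 1.
have dk : 1 <= n%:R - k%:R - 1 :> R.
  have : (k + 1 + 1)%:R <= n%:R :> R by rewrite ler_nat; lia.
  by rewrite !natrD; lra.
have z0 p : 0 < z p by rewrite /z; case: ifP; rewrite ?sqrtr_gt0 // => _; lra.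
apply: (collatz_le (@edge_sym G) z0 _ ev) => p.
rewrite /z; case: ifPn => pA.
  rewrite (eq_bigr (fun=> n%:R - k%:R - 1)); last first.
    by move=> q /bipA; rewrite pA; case: (q \in A).
  rewrite sumr_const -[_ *+ #|_|]mulr_natl -expr2 sqr_sqrtr ?(ltW s0) //.
  apply: le_trans ss; rewrite ler_wpM2r //; first by lra.
  rewrite lerBrDr natr1 ler_nat; apply: leq_trans Bk; rewrite ltnS.
  by apply/subset_leq_card/subsetP => q /bipA; rewrite pA inE; case: (q \in A).
rewrite (eq_bigr (fun=> Num.sqrt s)); last first.
  by move=> q /bipA; rewrite (negPf pA); case: (q \in A).
rewrite sumr_const -[_ *+ #|_|]mulr_natr ler_wpM2l ?sqrtr_ge0 //.
rewrite -addrA -opprD lerBrDr natr1 -natrD ler_nat -cG.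
have /(leq_trans kK) kc := @kappa_le_degree (compl G) p.
(* The degrees of p in G and in its complement add up to n - 1. *)
rewrite -(cardC (edge p)) leq_add2l (cardD1 p) inE -topredE /= edge_irrefl add1n ltnS.
apply: leq_trans kc _; apply/subset_leq_card/subsetP => q.
by rewrite !inE /= /compl_edge eq_sym.
Qed.

(* The host K_{2,1} minus an edge is disconnected, so Perron-Frobenius does not
   apply, but it only has one edge. *)
Lemma eigenfun_host_21 (T : finType) (A : {set T}) m (e : rel T) (c : R) v :
    involutive m -> (forall p, m p != p -> (m p \in A) = (p \notin A)) ->
    #|matched A m true| = 1%N -> #|A| = 2%N -> #|~: A| = 1%N ->
    symmetric e -> subrel e (host A m) -> c != 0 -> eigenfun e c v ->
  e =2 host A m.
Proof.
move=> mK mA ck cA cB e_sym eh c0 [[x vx] vA].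
have [y exy] : exists y, e x y.
  apply/existsP; apply: contraT => /existsPn no; move: (vA x).
  rewrite big_pred0 => [/esym/eqP|y]; last exact/negbTE/no.
  by rewrite mulf_eq0 (negPf c0) (negPf vx).
have [p [q [pA qA epq]]] : exists p q, [/\ p \in A, q \notin A & e p q].
  have := eh _ _ exy; rewrite /host => /andP[+ _].
  have [xA|xA] := boolP (x \in A); have [yA|yA] := boolP (y \in A) => // _.
    by exists x, y.
  by exists y, x; rewrite e_sym.
have /cards1P[r rB] : #|~: A| == 1%N by rewrite cB.
have Bq u : u \notin A -> u = q.
  have : q \in ~: A by rewrite inE.
  by rewrite -in_setC rB !inE => /eqP -> /eqP.
have mq : m q \in A /\ m q != q.
  have : (0 < #|matched A m false|)%N by rewrite card_matched ?ck.
  case/card_gt0P => u; rewrite !inE eqbF_neg => /andP[uA mu].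
  by move: mu; rewrite -(Bq u uA) => mu; rewrite mA.
have pmq : p != m q.
  by have /andP[_] := eh _ _ epq; apply: contraNneq => ->; rewrite mK.
have Ap u : u \in A -> u != m q -> u = p.
  move=> uA umq; apply/eqP; apply: contraT => up.
  have : (#|[set u; p; m q]| <= #|A|)%N.
    apply/subset_leq_card/subsetP => w; rewrite !inE.
    by case/orP => [/orP[]|] /eqP -> //; case: mq.
  by rewrite cA -setUA cardsU1 cards2 !inE negb_or up umq pmq.
have main u w : u \in A -> w \notin A -> host A m u w -> e u w.
  move=> uA wA /andP[_ muw]; rewrite (Bq w wA) in muw *.
  by rewrite (Ap u uA) //; apply: contraNneq muw => ->; rewrite mK.
move=> u w; apply/idP/idP => [|huw]; first exact: eh.
have /andP[+ _] := huw.
have [uA|uA] := boolP (u \in A); have [wA|wA] := boolP (w \in A) => // _.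
  exact: main.
by rewrite e_sym main // host_sym.
Qed.

End Comparison.

Theorem proposition4p3 (R : realType) (k n : nat) (G : sgraph) :
  1 <= k -> 2 * k + 1 <= n ->
  bipartite G -> #|G| = n -> k <= kappa (compl G) ->
  (rho R G <= rho R (B n k))%R /\
  (rho R G = rho R (B n k) <-> isomorphic G (B n k)).
Proof.
move=> k1 kn bipG cG kK.
have {bipG}[A [bipA BA]] : exists A : {set G},
    (forall x y : G, edge x y -> (x \in A) != (y \in A)) /\ #|~: A| <= #|A|.
  have [A bipA] := bipG.
  have [le|lt] := leqP #|~: A| #|A|; first by exists A.
  exists (~: A); rewrite setCK (ltnW lt); split=> // x y /bipA.
  by rewrite !inE; case: (x \in A); case: (y \in A).
have cAB : #|A| + #|~: A| = n by rewrite -cG cardsC.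
pose u : R := (uphalf n)%:R%R; pose d : R := (n./2)%:R%R.
have rk1 : (1 <= k%:R :> R)%R by rewrite ler1n.
have rku : (k%:R <= u)%R by rewrite ler_nat; lia.
have rkd : (k%:R <= d)%R by rewrite ler_nat; lia.
have rkn : (2 * k%:R + 1 <= n%:R :> R)%R.
  by rewrite -natrM natr1 ler_nat; lia.
have ud : (u + d = n%:R)%R by rewrite -natrD; congr (_%:R)%R; lia.
have [t top] := exists_top rk1 rku rkd.
have rB := rho_B k1 kn top.
have t1 : (1 <= t)%R by apply: top_ge1 top; rewrite ?ud.
have t0 : (0 < t)%R by apply: lt_le_trans t1.
(* A bound below t gives strict inequality, and then both sides of the equivalence are false. *)
have of_lt s : (0 < s < t)%R ->
    (forall c, eigenvalue (adjmx R G) c -> c <= Num.sqrt s)%R ->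
    (rho R G <= rho R (B n k))%R /\
    (rho R G = rho R (B n k) <-> isomorphic G (B n k)).
  move=> /andP[s0 st] es; have lt : (rho R G < rho R (B n k))%R.
    rewrite rB; apply: le_lt_trans (rho_le (sqrtr_ge0 s) es) _.
    by rewrite ltr_sqrt.
  split; first exact: ltW.
  by split=> [e|/(isomorphic_rho R) e]; rewrite e ltxx in lt.
have [Bk|kB] := ltnP #|~: A| k.
  have t1t : ((k%:R - 1) * (n%:R - k%:R - 1) < t)%R.
    apply: (small_lt_top rk1 rku rkd rkn ud _ _ top).
      rewrite -natrX -natrM -natrM lerBlDr natr1 ler_nat.
      exact: sqr_le_uphalf_half.
    case: (ltngtP k 1) k1 => // [k2 _|->]; [right|by left].
    by rewrite ler_nat.
  pose t1' : R := ((k%:R - 1) * (n%:R - k%:R - 1))%R.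
  have t1ge0 : (0 <= t1')%R by rewrite mulr_ge0 //; lra.
  (* For k = 1 the bound (k - 1)(n - k - 1) is 0; its midpoint with t is positive and still below
     t. *)
  apply: (of_lt ((t1' + t) / 2)%R).
    by move: t1t; rewrite -/t1' => t1t; apply/andP; split; lra.
  move=> c; apply: (eigenvalue_small_part bipA cG kK kn Bk).
    by lra.
  by move: t1t; rewrite -/t1' => t1t; lra.
have kA : k < #|A| by lia.
have [M [/subsetP ME cM M_fst M_snd]] := konig (compl_cover_ge (ltnW kA) kB kK).
have M_bip x y : (x, y) \in M -> x \in A /\ y \notin A.
  by move/ME; rewrite inE => /and3P[].
have mK := mateK M_bip M_fst M_snd; have mA := mate_side M_bip.
set m := mate M in mK mA.
have ck : #|matched A m true| = k by rewrite card_mate.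
have sym : symmetric (@edge G) by exact: edge_sym.
have eh : subrel (@edge G) (host A m).
  move=> x y exy; rewrite /host bipA //=; have := bipA _ _ exy.
  have no p q : p \in A -> q \notin A -> edge p q -> m p != q.
    move=> pA qA epq; rewrite (mateE M_bip) //; apply/negP => /ME.
    by rewrite inE /= epq !andbF.
  have [xA|xA] := boolP (x \in A); have [yA|yA] := boolP (y \in A) => // _.
    exact: no.
  by rewrite (inv_eq mK) eq_sym no // edge_sym.
have rkA : (k%:R < #|A|%:R :> R)%R by rewrite ltr_nat.
have rkB : (k%:R <= #|~: A|%:R :> R)%R by rewrite ler_nat.
have rA1 : (1 < #|A|%:R :> R)%R by rewrite ltr1n (leq_ltn_trans k1).
have [t' top'] := exists_top rk1 (ltW rkA) rkB.
have rAB : (#|A|%:R + #|~: A|%:R = n%:R :> R)%R by rewrite -natrD cAB.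
have t1' : (1 <= t')%R by apply: top_ge1 top'; rewrite ?rAB // ltW.
have t0' : (0 < t')%R by apply: lt_le_trans t1'.
have bound s c : (0 < s)%R -> is_top #|A|%:R%R #|~: A|%:R%R k%:R%R s ->
    eigenvalue (adjmx R G) c -> (c <= Num.sqrt s)%R.
  rewrite -ck in rk1 rkB rkA * => s0 tops /eigenvalue_adjmxP[v].
  exact: (eigenfun_le_top mK mA rA1 rk1 rkB rkA tops s0 sym eh).
have [cA|neA] := eqVneq #|A| (uphalf n); last first.
  (* Nonempty classes whose sizes differ by at least 2 have total size at least 4, so t' > 1 and the
     comparison of roots is strict. *)
  have n4 : 4 <= n by clear -kA kB k1 cAB neA; lia.
  have gt1 : (1 < t')%R.
    by apply: (top_gt1 rk1 (ltW rkA) rkB _ _ top'); rewrite rAB // ler_nat.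
  apply: (of_lt t'); last by move=> c; apply: bound.
  rewrite t0' /=; apply: (top_mono _ _ gt1 top' top); first by rewrite rAB ud.
  by rewrite -!natrM ltr_nat -cAB mul_lt_uphalf_half ?cAB.
have cB : #|~: A| = n./2 by clear -cAB cA; lia.
have topA : is_top #|A|%:R%R #|~: A|%:R%R k%:R%R t by rewrite cA cB.
split; first by rewrite rB; apply: rho_le => [|c]; [exact: sqrtr_ge0 | exact: bound].
split=> [erho|]; last exact: isomorphic_rho.
have st0 : (Num.sqrt t != 0)%R by rewrite gt_eqF // sqrtr_gt0.
have [v ev] : exists v, eigenfun (@edge G) (Num.sqrt t) v.
  apply/eigenvalue_adjmxP; rewrite -rB -erho; apply: eigenvalue_rho.
  by rewrite erho rB.
have d0 : 0 < n./2 by clear -k1 kn; lia.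
apply: (host_isomorphic_B mK mA ck cA cB d0).
(* A single vertex outside A forces k = 1 and, by balance and k < |A|, a host K_{2,1} minus an
   edge. *)
have [B1|B1] := leqP #|~: A| 1; last first.
  rewrite -ck in rk1 rkB rkA topA.
  apply: (eigenfun_top_host mK mA rA1 rk1 rkB rkA topA t0 _ sym eh ev).
  by rewrite ltr1n.
have cB1 : #|~: A| = 1 by apply/eqP; rewrite eqn_leq B1 (leq_trans k1).
by apply: (eigenfun_host_21 mK mA _ _ cB1 sym eh st0 ev);
  clear -k1 kn kB kA cAB cB cA B1 ck; lia.
Qed.
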